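(* Let $F\subseteq\mathbb{R}^n$, $f\colon\mathbb{R}^n\to\mathbb{R}$, let $(\mathcal{C},\mathcal{D},g,z,\mathcal{T},\epsilon)$ be an $(F,f)$-valid configuration, and let $C\subseteq\mathbb{R}^n$. Suppose there exists a map $\omega\colon\mathbb{R}^n\to\mathbb{R}^n$ such that for all $x\in\mathbb{R}^n$: if $x\in\bigcap(\mathcal{C}\cup\mathcal{D})$ and $x\notin C$, then $$\omega(x)\in\bigcap\mathcal{C},\qquad \omega(x)\succ_{\epsilon,\mathcal{T}}x,\qquad g(\omega(x))\le g(x).$$ Then $(\mathcal{C},\mathcal{D}\cup\{C\},g,z,\mathcal{T},\epsilon)$ is also $(F,f)$-valid.
   Context: Constraints are arbitrary subsets of $\mathbb{R}^n$. For $\mathcal{C}\subseteq\mathcal{P}(\mathbb{R}^n)$ (power set) write $\bigcap\mathcal{C}=\bigcap_{C\in\mathcal{C}}C$, with $\bigcap\emptyset=\mathbb{R}^n$. For a list $\tau=(i_1,\dots,i_k)\in\{\pm1,\dots,\pm n\}^k$ write $\tau(x)=(\mathrm{sgn}(i_1)x_{|i_1|},\dots,\mathrm{sgn}(i_k)x_{|i_k|})\in\mathbb{R}^k$ for $x\in\mathbb{R}^n$ and $\tau(C)=\{\tau(x):x\in C\}$ for $C\subseteq\mathbb{R}^n$; the empty list is allowed. For another list $\tau'=(i'_1,\dots,i'_{k'})$, write $\tau\trianglelefteq\tau'$ if $k\le k'$ and $i_j=i'_j$ for all $1\le j\le k$. For a node $v$ of a directed graph, $\delta^+(v)$ is its set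 of children. Branching tree: a tuple $\mathcal{T}=(V,E,B,\sigma)$ is a $\mathcal{C}$-consistent branching tree if: (T1) $(V,E)$ is an arborescence with $1\le|V|<\infty$ and root $r\in V$. (T2) Each $v\in V$ has a branching constraint $B_v\subseteq\mathbb{R}^n$, and $B_r=\mathbb{R}^n$. (T3) For all $u\in V$ with $\delta^+(u)\ne\emptyset$: $\bigcap\mathcal{C}\subseteq\bigcup_{v\in\delta^+(u)}B_v$. (T4) Each $v\in V$ has a list $\sigma_v\in\{\pm1,\dots,\pm n\}^{\ell_v}$, $\ell_v\in\{0,\dots,n\}$, with $|(\sigma_v)_1|,\dots,|(\sigma_v)_{\ell_v}|$ pairwise distinct. (T5) $\sigma_u\trianglelefteq\sigma_v$ for all $u\in V$, $v\in\delta^+(u)$. (T6) For all $v\in V$ and $1\le i\le\ell_v$: $\max\{\sigma_v(x)_i:x\in\bigcap\mathcal{C}\}<\infty$ (i.e. the set is bounded above). (T7) For all $u\in V$ and $v\ne w$ in $\delta^+(u)$: $\sigma_u(B_v)\cap\sigma_u(B_w)=\emptyset$. Relations: for $v\in V$ let $\mathcal{B}_v=\{B_u: u \text{ is a node on the } r\text{-}v\text{-path in } \mathcal{T}\}$. For $x,y\in\bigcap\mathcal{C}$ let $\mathrm{dcn}(x,y)$ be the deepest node $w\in V$ with $x,y\in\bigcap(\mathcal{C}\cup\mathcal{B}_w)$. For $\epsilon>0$ and $a,b\in\mathbb{R}^k$, let $a\succ_\epsilon b$ mean $a\neq b$ and $a_i\ge b_i+\epsilon$ for the smallest index $i$ with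 $a_i\ne b_i$. For $x,y\in\bigcap\mathcal{C}$ and $v=\mathrm{dcn}(x,y)$: $x\succeq_{\epsilon,\mathcal{T}}y$ iff $\sigma_v(x)=\sigma_v(y)$ or $\sigma_v(x)\succ_\epsilon\sigma_v(y)$; $x\succ_{\epsilon,\mathcal{T}}y$ iff $\sigma_v(x)\succ_\epsilon\sigma_v(y)$. Configuration: let $F\subseteq\mathbb{R}^n$, $f\colon\mathbb{R}^n\to\mathbb{R}$. A configuration $(\mathcal{C},\mathcal{D},g,z,\mathcal{T},\epsilon)$ with $\mathcal{C},\mathcal{D}\subseteq\mathcal{P}(\mathbb{R}^n)$, $g\colon\mathbb{R}^n\to\mathbb{R}$, $z\in\mathbb{R}\cup\{\infty\}$, $\mathcal{T}$ a branching tree and $\epsilon$ a real number is $(F,f)$-valid if: (V1) $\mathcal{T}$ is $\mathcal{C}$-consistent and $\epsilon>0$. (V2) If $z<\infty$, there exists $x\in F$ with $f(x)\le z$. (V3) For all real $\hat z<z$, there exists $x\in F$ with $f(x)\le\hat z$ if and only if there exists $x\in\bigcap\mathcal{C}$ with $g(x)\le\hat z$. (V4) For every $x\in\bigcap\mathcal{C}$ with $g(x)<z$ there exists $y\in\bigcap(\mathcal{C}\cup\mathcal{D})$ with $y\succeq_{\epsilon,\mathcal{T}}x$ and $g(y)\le g(x)$. *)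

(* Defs.v *)
From HB Require Import structures.
From mathcomp Require Import all_boot all_order all_algebra.
From mathcomp Require Import all_classical all_reals all_analysis.

Set Implicit Arguments.
Unset Strict Implicit.
Unset Printing Implicit Defensive.

Import Order.TTheory GRing.Theory Num.Theory.

Local Open Scope classical_set_scope.
Local Open Scope ring_scope.

Definition feas (R : realType) (n : nat) (CC : set (set 'rV[R]_n)) :
  set 'rV[R]_n := \bigcap_(A in CC) A.

(* An element of {±1, ..., ±n} is a pair of a sign bit ([true] for -) and a
   0-based index: [(b, i)] stands for (-1)^b (i + 1). *)
Definition signed_index (n : nat) : Type := (bool * 'I_n)%type.

Definition apply_list (R : realType) (n : nat) (tau : seq (signed_index n))
    (x : 'rV[R]_n) : 'rV[R]_(size tau) :=
  \row_(j < size tau)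
    let i := tnth (in_tuple tau) j in (-1) ^+ i.1 * x 0 i.2.

(* The root is determined by the edges of an arborescence; it is stored so
   that it can be named. *)
Record branching_tree (R : realType) (n : nat) := BranchingTree {
  node : finType;
  edge : rel node;
  root : node;
  bconstr : node -> set 'rV[R]_n;
  slist : node -> seq (signed_index n)
}.

(* [path] describes walks, possibly with repeated nodes, so uniqueness also
   rules out cycles, in particular edges entering the root. *)
Definition arborescence (V : finType) (E : rel V) (r : V) : Prop :=
  forall v : V, exists! p : seq V, path E r p /\ last r p = v.

Section Tree.
Variables (R : realType) (n : nat).
Implicit Types (CC : set (set 'rV[R]_n)) (T : branching_tree R n).

Definition root_path T (v : node T) : {set node T} :=
  [set u | `[< exists p : seq (node T),
     [/\ path (@edge _ _ T) (root T) p, last (root T) p = v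
       & u \in root T :: p] >]]%SET.

Definition depth T (v : node T) : nat := #|root_path v|.-1.

Record consistent CC T : Prop := Consistent {
  tree_arborescence : arborescence (@edge _ _ T) (root T);
  tree_root : bconstr (root T) = setT;
  tree_cover : forall u : node T, (exists v, edge u v) ->
    feas CC `<=` \bigcup_(v in [set v | edge u v]) bconstr v;
  tree_slist : forall v : node T,
    (size (slist v) <= n)%N /\ uniq [seq i.2 | i <- slist v];
  tree_prefix : forall u v : node T, edge u v -> prefix (slist u) (slist v);
  tree_bounded : forall (v : node T) (i : 'I_(size (slist v))),
    has_ubound [set apply_list (slist v) x 0 i | x in feas CC];
  tree_disjoint : forall u v w : node T, edge u v -> edge u w -> v <> w ->
    apply_list (slist u) @` bconstr v `&` apply_list (slist u) @` bconstr w
      = set0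
}.

Definition path_constrs T (v : node T) : set (set 'rV[R]_n) :=
  [set bconstr u | u in [set` root_path v]].

(* In a [CC]-consistent tree, for x and y in [feas CC], the root is a candidate
   and the maximizer of the depth is unique. The value on other arguments is
   irrelevant. *)
Definition dcn CC T (x y : 'rV[R]_n) : node T :=
  [arg max_(w > root T | `[< feas (CC `|` path_constrs w) x /\
                            feas (CC `|` path_constrs w) y >]) depth w]%N.

Definition lex_gt (eps : R) (k : nat) (a b : 'rV[R]_k) : Prop :=
  a <> b /\
  forall i : 'I_k, a 0 i <> b 0 i ->
    (forall j : 'I_k, (j < i)%N -> a 0 j = b 0 j) -> b 0 i + eps <= a 0 i.

Definition tree_gt CC T (eps : R) (x y : 'rV[R]_n) : Prop :=
  let s := slist (dcn CC T x y) in
  lex_gt eps (apply_list s x) (apply_list s y).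

Definition tree_ge CC T (eps : R) (x y : 'rV[R]_n) : Prop :=
  let s := slist (dcn CC T x y) in
  apply_list s x = apply_list s y \/
  lex_gt eps (apply_list s x) (apply_list s y).

Record valid (F : set 'rV[R]_n) (f : 'rV[R]_n -> R)
    (CC DD : set (set 'rV[R]_n)) (g : 'rV[R]_n -> R) (z : \bar R)
    (T : branching_tree R n) (eps : R) : Prop := Valid {
  valid_z : z <> -oo%E;
  valid_tree : consistent CC T /\ 0 < eps;
  valid_witness : (z < +oo)%E -> exists2 x, F x & ((f x)%:E <= z)%E;
  valid_value : forall t : R, (t%:E < z)%E ->
    ((exists2 x, F x & f x <= t) <-> (exists2 x, feas CC x & g x <= t));
  valid_dominance : forall x, feas CC x -> ((g x)%:E < z)%E ->
    exists y, [/\ feas (CC `|` DD) y, tree_ge CC T eps y x & g y <= g x]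
}.

End Tree.

(* Main.v *)
Require Import Defs.
From mathcomp Require Import all_boot all_order all_algebra.
From mathcomp Require Import all_classical all_reals all_analysis.

Set Implicit Arguments.
Unset Strict Implicit.
Unset Printing Implicit Defensive.

Import Order.TTheory GRing.Theory Num.Theory.

Local Open Scope classical_set_scope.
Local Open Scope ring_scope.

(** Only the dominance condition changes when [C] is added to [DD]. Starting from
    [x], the map [omega] moves a point violating [C] to a strictly preferred
    one, the old dominance condition brings it back into [feas (CC `|` DD)],
    and one would like to iterate until [C] holds. So among the points of
    [feas (CC `|` DD)] that dominate [x] and cost at most [g x], choose one, [m],
    that is maximal for the strict relation [tree_gt]; if [m] violated [C],
    passing to [omega m] and then to a point of [feas (CC `|` DD)] dominating it
    would give a strictly preferred candidate. Two facts about the relations make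
    this work.

    Transitivity. The nodes whose path constraints hold at a point [x], written
    [nodes_at x], form a chain in the tree, since siblings have disjoint
    constraints, and [dcn x y] is the deepest node of [nodes_at x :&: nodes_at y].
    For x, y and z, the nodes [dcn x y] and [dcn y z] both lie in the chain
    of y, and the shallower of them lies above [dcn x z]; as the lists grow down
    the tree, the two lexicographic comparisons are inherited by [dcn x z]
    ([tree_gt_trans]). Dominance adds to [tree_gt] only the case where
    the lists of x and y agree at [dcn x y]. Then x and y have the same
    chain ([dcn_eq_nodes_at]): otherwise the two points would enter distinct
    children of that node, whose constraints are disjoint even after applying
    the list. Such points are interchangeable in every comparison, so the mixed
    forms of transitivity follow from the strict one.

    Existence of maximal elements ([tree_gt_maximal]). On the points with a given
    chain, [tree_gt] is the lexicographic comparison of one fixed list, whose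
    entries are bounded above and whose jumps are at least [eps], so maximal
    elements exist ([lex_beats_maximal]). There are finitely many chains, and a
    transitive relation with maximal elements inside each of finitely many
    classes has a maximal element overall ([maximal_by_label]). *)

(** * Maximal elements *)

Section LexBeats.
Variables (R : realType) (eps : R).
Hypothesis eps_gt0 : 0 < eps.

(** The coordinates are functions of a natural number, so that lists of different
    lengths, at different nodes, can be compared without casts. *)
Definition lex_beats (X : Type) (c : nat -> X -> R) (k : nat) (x y : X) :=
  exists2 i, (i < k)%N &
    (forall j, (j < i)%N -> c j x = c j y) /\ c i y + eps <= c i x.

(** Coordinates are settled one at a time: among the points agreeing with the
    current choice so far, one within [eps] of the supremum of the next
    coordinate cannot be beaten there. *)
Lemma lex_beats_maximal (X : Type) (c : nat -> X -> R) (k : nat) (S : set X) :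
  S !=set0 -> (forall i, (i < k)%N -> has_ubound (c i @` S)) ->
  exists2 m, S m & forall y, S y -> ~ lex_beats c k y m.
Proof.
move=> S0; elim: k => [|k IHk] ub.
  by have [m Sm] := S0; exists m => // y _ [].
have [m Sm max_m] := IHk (fun i lt_ik => ub i (leqW lt_ik)).
pose S' := [set y | S y /\ forall j, (j < k)%N -> c j y = c j m].
have supS' : has_sup (c k @` S').
  split; first by exists (c k m), m.
  have [b bP] := ub k (ltnSn k).
  by exists b => _ [y [Sy _] <-]; apply: bP; exists y.
have [_ [m' [Sm' eq_m'] <-] near_sup] := sup_adherent eps_gt0 supS'.
exists m' => // y Sy [i]; rewrite ltnS leq_eqVlt => /predU1P[->|lt_ik] [eq_y jump].
  have: c k y <= sup (c k @` S').
    apply: sup_upper_bound => //; exists y => //; split => // j lt_jk.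
    by rewrite eq_y // eq_m'.
  by apply/negP; rewrite -ltNge; apply: lt_le_trans jump; rewrite -ltrBlDr.
apply: (max_m y Sy); exists i => //; split; last by rewrite -eq_m'.
by move=> j lt_ji; rewrite eq_y // eq_m' // (ltn_trans lt_ji).
Qed.

End LexBeats.

(** Treat the labels in turn: above the current point, either no element has the
    label, or one moves to a maximal element among those that do. By
    transitivity, later moves do not spoil the labels already treated. *)
Lemma maximal_by_label (X : Type) (L : finType) (label : X -> L)
    (r : X -> X -> Prop) (S : set X) :
  S !=set0 ->
  (forall x y z, S x -> S y -> S z -> r x y -> r y z -> r x z) ->
  (forall (l : L) (S' : set X), S' `<=` S -> S' `<=` [set x | label x = l] ->
     S' !=set0 -> exists2 m, S' m & forall y, S' y -> ~ r y m) ->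
  exists2 m, S m & forall y, S y -> ~ r y m.
Proof.
move=> [x0 Sx0] trans_r max_l.
suff [m Sm max_m] : exists2 m, S m &
    forall y, S y -> label y \in enum L -> ~ r y m.
  by exists m => // y Sy; apply: max_m; rewrite ?mem_enum.
elim: (enum L) => [|l s [y Sy max_y]]; first by exists x0.
pose S' := [set y' | [/\ S y', r y' y & label y' = l]].
have [S'0|noS'] := pselect (S' !=set0); last first.
  exists y => // y' Sy'; rewrite inE => /predU1P[eq_l|]; last exact: max_y.
  by move=> ry'; apply: noS'; exists y'.
have [|| m [Sm rmy _] max_m] := max_l l S' _ _ S'0; try by move=> ? [].
exists m => // y' Sy' in_s ry'; have ry'y := trans_r _ _ _ Sy' Sm Sy ry' rmy.
move: in_s; rewrite inE => /predU1P[eq_l|in_s]; first exact: (max_m y').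
exact: (max_y y').
Qed.

(** * Lexicographic comparison along signed lists *)

Section SignedLists.
Variables (R : realType) (n : nat).
Implicit Types (s t : seq (signed_index n)) (x y : 'rV[R]_n).

Definition coord s (j : nat) x : R :=
  nth 0 [seq (-1) ^+ nat_of_bool i.1 * x 0 i.2 | i : signed_index n <- s] j.

Lemma apply_listE s x (j : 'I_(size s)) : apply_list s x 0 j = coord s j x.
Proof.
rewrite mxE /coord; set i0 := tnth _ j; rewrite (nth_map i0) //.
by have <- : i0 = nth i0 s j by apply: tnth_nth.
Qed.

Lemma coord_prefix s t (j : nat) x :
  prefix s t -> (j < size s)%N -> coord t j x = coord s j x.
Proof. by move=> /prefixP[u ->] lt_j; rewrite /coord map_cat nth_cat size_map lt_j. Qed.

Lemma apply_list_eqP s x y :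
  apply_list s x = apply_list s y <->
  forall j, (j < size s)%N -> coord s j x = coord s j y.
Proof.
split=> [eq_xy j lt_j | eq_xy]; first by rewrite -!(apply_listE _ (Ordinal lt_j)) eq_xy.
by apply/rowP => j; rewrite !apply_listE eq_xy.
Qed.

Lemma apply_list_eq_prefix s t x y :
  prefix s t -> apply_list t x = apply_list t y -> apply_list s x = apply_list s y.
Proof.
move=> pre_st /apply_list_eqP eq_xy; apply/apply_list_eqP => j lt_j.
rewrite -!(coord_prefix _ pre_st lt_j); apply: eq_xy.
by rewrite (leq_trans lt_j) // size_prefix.
Qed.

(** The first difference named as a witness; a jump of [eps] then already makes
    the two lists differ, which is where positivity of [eps] enters. *)
Lemma lex_gtP (eps : R) s x y : 0 < eps ->
  lex_gt eps (apply_list s x) (apply_list s y) <->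
  lex_beats eps (coord s) (size s) x y.
Proof.
move=> eps_gt0; split=> [[neq_xy first_xy] | [i lt_i [eq_i jump]]].
  have ex_i : exists i : 'I_(size s), coord s i x != coord s i y.
    apply/existsP; rewrite -[X in is_true X]negbK negb_exists.
    apply/negP => /forallP eq_xy.
    by apply/neq_xy/rowP => i; rewrite !apply_listE; apply/eqP/negPn/eq_xy.
  have [i0 neq_i0] := ex_i.
  case: (arg_minnP (P := fun j : 'I_(size s) => coord s j x != coord s j y)
           (fun j => val j) neq_i0) => i neq_i min_i.
  have eq_i j : (j < i)%N -> coord s j x = coord s j y.
    move=> lt_ji; apply/eqP; apply: contraLR lt_ji => neq_j; rewrite -leqNgt.
    case: (ltnP j (size s)) => [lt_j|le_j]; first exact: (min_i (Ordinal lt_j)).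
    by rewrite (leq_trans _ le_j) // ltnW.
  exists i => //; split=> //; rewrite -!apply_listE; apply: first_xy.
    by rewrite !apply_listE; apply/eqP.
  by move=> j lt_ji; rewrite !apply_listE eq_i.
have neq_i : coord s i x <> coord s i y.
  by move=> eq_xy; move: jump; rewrite eq_xy gerDl leNgt eps_gt0.
split=> [/apply_list_eqP/(_ i lt_i) //|j]; rewrite !apply_listE => neq_j eq_j.
case: (ltngtP j i) => [lt_ji|lt_ij|-> //]; first by have := eq_i _ lt_ji.
by case: neq_i; rewrite -!(apply_listE _ (Ordinal lt_i)); apply: eq_j.
Qed.

(** [s], [t] and [q] will be the lists at [dcn x y], [dcn y z] and [dcn x z]. The
    first difference of x and z is at the smaller of the two given
    indices, which falls in the shorter of [s] and [t]; up to there the three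
    lists coincide. *)
Lemma lex_beats_trans (eps : R) s t q x y z : 0 < eps ->
  lex_beats eps (coord s) (size s) x y -> lex_beats eps (coord t) (size t) y z ->
  prefix s t /\ prefix s q \/ prefix t s /\ prefix t q ->
  lex_beats eps (coord q) (size q) x z.
Proof.
move=> eps_gt0 [i lt_i [eq_i jump_i]] [j lt_j [eq_j jump_j]] pre.
have [m [lt_m le_m coord_s coord_t]] : exists m, [/\ (minn i j < m)%N,
    (m <= size q)%N, (forall l a, (l < m)%N -> coord s l a = coord q l a) &
    forall l a, (l < m)%N -> coord t l a = coord q l a].
  case: pre => -[pre1 pre2]; [exists (size s) | exists (size t)]; split;
    rewrite ?gtn_min ?lt_i ?lt_j ?orbT ?(size_prefix pre2) // => l a lt_l;
    by rewrite ?(coord_prefix _ pre1 lt_l) ?(coord_prefix _ pre2 lt_l).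
exists (minn i j); first exact: leq_trans le_m.
split=> [l|]; first rewrite leq_min => /andP[lt_li lt_lj].
  have lt_lm : (l < m)%N by apply: ltn_trans lt_m; rewrite leq_min lt_li.
  by rewrite -coord_s // eq_i // coord_s // -coord_t // eq_j // coord_t.
case: (ltngtP i j) lt_m => [lt_ij|lt_ji|eq_ij] lt_m.
- by rewrite -(coord_t _ z) // -eq_j // coord_t // -!coord_s //.
- by rewrite -(coord_s _ x) // eq_i // coord_s // -!coord_t //.
- rewrite -eq_ij in jump_j.
  move: jump_i jump_j; rewrite !coord_s // !coord_t // => jump_i jump_j.
  by apply: le_trans jump_i; apply: le_trans jump_j _; rewrite lerDl ltW.
Qed.

End SignedLists.

(** * Nodes whose path constraints hold at a point *)

Section Tree.
Variables (R : realType) (n : nat) (CC : set (set 'rV[R]_n)).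
Variable T : branching_tree R n.
Hypothesis consT : consistent CC T.
Implicit Types (x y z : 'rV[R]_n) (u v w : node T) (p q : seq (node T)).

Local Notation edge := (@edge R n T).
Local Notation root := (Defs.root T).

Lemma root_walk_inj p q :
  path edge root p -> path edge root q -> last root p = last root q -> p = q.
Proof.
move=> walk_p walk_q eq_last.
have [p0 [_ uniq_p0]] := tree_arborescence consT (last root q).
by rewrite -(uniq_p0 p) // -(uniq_p0 q).
Qed.

Lemma root_walk v : exists2 p, path edge root p & last root p = v.
Proof. by have [p [[walk_p last_p] _]] := tree_arborescence consT v; exists p. Qed.

Lemma mem_root_path p u :
  path edge root p -> (u \in root_path (last root p)) = (u \in root :: p).
Proof.
move=> walk_p; rewrite inE; apply/asboolP/idP => [[q [walk_q last_q]]|in_p].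
  by rewrite (root_walk_inj walk_q walk_p).
by exists p.
Qed.

Lemma root_path_split u v : u \in root_path v ->
  exists p q, [/\ path edge root p, last root p = u, path edge u q & last u q = v].
Proof.
have [p walk_p <-] := root_walk v; rewrite mem_root_path // => in_p.
case/splitPl: in_p walk_p => p1 p2 <-; rewrite cat_path last_cat => /andP[? ?].
by exists p1, p2.
Qed.

Lemma root_path_refl v : v \in root_path v.
Proof. by have [p walk_p <-] := root_walk v; rewrite mem_root_path // mem_last. Qed.

Lemma root_path_trans u v w :
  u \in root_path v -> v \in root_path w -> u \in root_path w.
Proof.
move=> in_uv /root_path_split[p [q [walk_p last_p walk_q <-]]].
rewrite -last_p -last_cat mem_root_path ?cat_path ?walk_p ?last_p //.
by rewrite -cat_cons mem_cat -mem_root_path // last_p in_uv.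
Qed.

Lemma root_path_edge u v : edge u v -> root_path v = (v |: root_path u)%SET.
Proof.
have [p walk_p <-] := root_walk u => e_v; apply/setP => w.
rewrite -(last_rcons root p v) mem_root_path ?rcons_path ?walk_p // -rcons_cons.
by rewrite mem_rcons in_cons in_setU1 mem_root_path // last_rcons.
Qed.

Lemma edge_notin_root_path u v : edge u v -> v \notin root_path u.
Proof.
move=> e_v; apply/negP => /root_path_split[p [q [walk_p last_p walk_q last_q]]].
have walk : path edge root (p ++ rcons q v).
  by rewrite cat_path walk_p last_p rcons_path walk_q last_q.
have /(congr1 size) : p ++ rcons q v = p.
  by apply: root_walk_inj; rewrite // last_cat last_p last_rcons.
by rewrite size_cat size_rcons -[RHS]addn0 => /addnI.
Qed.

Lemma slist_root_path u v : u \in root_path v -> prefix (slist u) (slist v).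
Proof.
case/root_path_split => _ [q [_ _ walk_q <-]] {v}.
elim: q u walk_q => [|v q IHq] u /=; first by rewrite prefix_refl.
by move=> /andP[/(tree_prefix consT) pre_uv /IHq]; apply: prefix_trans.
Qed.

Definition nodes_at x : {set node T} :=
  [set w | `[< forall u, u \in root_path w -> bconstr u x >]]%SET.

Lemma nodes_atP x w :
  reflect (forall u, u \in root_path w -> bconstr u x) (w \in nodes_at x).
Proof. by rewrite inE; apply: asboolP. Qed.

Lemma nodes_at_up x u v : u \in root_path v -> v \in nodes_at x -> u \in nodes_at x.
Proof.
move=> in_uv /nodes_atP at_v; apply/nodes_atP => w in_wu.
by apply: at_v; apply: root_path_trans in_uv.
Qed.

Lemma root_nodes_at x : root \in nodes_at x.
Proof.
apply/nodes_atP => u; rewrite (@mem_root_path [::]) // inE => /eqP->.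
by rewrite (tree_root consT).
Qed.

Lemma bconstr_sibling u v w x y : edge u v -> edge u w ->
  apply_list (slist u) x = apply_list (slist u) y ->
  bconstr v x -> bconstr w y -> v = w.
Proof.
move=> e_v e_w eq_xy Bx By; apply: contrapT => neq_vw.
suff : (set0 : set 'rV[R]_(size (slist u))) (apply_list (slist u) x) by [].
rewrite -(tree_disjoint consT e_v e_w neq_vw).
by split; [exists x | exists y].
Qed.

(** The walks to [u] and [v] through constraints holding at [x] cannot diverge,
    since two siblings are never both satisfied at [x]. *)
Lemma nodes_at_chain x u v : u \in nodes_at x -> v \in nodes_at x ->
  (u \in root_path v) || (v \in root_path u).
Proof.
have [p walk_p <-] := root_walk u; have [q walk_q <-] := root_walk v.
move=> /nodes_atP at_u /nodes_atP at_v.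
have Bp w : w \in p -> bconstr w x.
  by move=> in_p; apply: at_u; rewrite mem_root_path // inE in_p orbT.
have Bq w : w \in q -> bconstr w x.
  by move=> in_q; apply: at_v; rewrite mem_root_path // inE in_q orbT.
suff : prefix p q || prefix q p.
  case/orP => /prefixP[s def_q]; apply/orP; [left|right];
    by rewrite mem_root_path // def_q -cat_cons mem_cat mem_last.
(* The starting node varies too, so that the induction follows both walks. *)
elim: p q (root) walk_p walk_q Bp Bq {at_u at_v} => [|a p IHp] [|b q] r0 //=.
move=> /andP[e_a walk_p] /andP[e_b walk_q] Bp Bq.
have eq_ab : a = b.
  by apply: bconstr_sibling (e_a) (e_b) _ (Bp _ _) (Bq _ _); rewrite ?inE ?eqxx.
rewrite -eq_ab !eqxx /=; apply: (IHp q a) => //; first by rewrite eq_ab.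
  by move=> w in_p; apply: Bp; rewrite inE in_p orbT.
by move=> w in_q; apply: Bq; rewrite inE in_q orbT.
Qed.

Lemma nodes_at_depth x u v : u \in nodes_at x -> v \in nodes_at x ->
  (depth u <= depth v)%N -> u \in root_path v.
Proof.
move=> at_u at_v le_uv; case/orP: (nodes_at_chain at_u at_v) => // in_vu.
have gt0 w : (0 < #|root_path w|)%N by apply/card_gt0P; exists w; apply: root_path_refl.
suff -> : root_path v = root_path u by apply: root_path_refl.
apply/eqP; rewrite eqEcard -(prednK (gt0 u)) -(prednK (gt0 v)) ltnS le_uv andbT.
by apply/fintype.subsetP => w in_wv; apply: root_path_trans in_vu.
Qed.

Definition deepest (D : {set node T}) : node T :=
  [arg max_(w > root | w \in D) depth w]%N.

Lemma feas_path_constrs x w :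
  feas CC x -> feas (CC `|` path_constrs w) x <-> w \in nodes_at x.
Proof.
move=> feas_x; split=> [feas_w|/nodes_atP at_w A].
  by apply/nodes_atP => u in_uw; apply: feas_w; right; exists u.
by move=> [/feas_x //|[u in_uw <-]]; apply: at_w.
Qed.

Lemma dcnE x y : feas CC x -> feas CC y ->
  dcn CC T x y = deepest (nodes_at x :&: nodes_at y).
Proof.
move=> feas_x feas_y; rewrite /dcn /deepest.
congr (fintype.extremum _ _ _ _); apply: funext => w.
rewrite finset.in_setI.
have [to_x of_x] := feas_path_constrs w feas_x.
have [to_y of_y] := feas_path_constrs w feas_y.
by apply/asboolP/andP => -[w_x w_y]; split; auto.
Qed.

Lemma dcnC x y : feas CC x -> feas CC y -> dcn CC T x y = dcn CC T y x.
Proof. by move=> feas_x feas_y; rewrite !dcnE // finset.setIC. Qed.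

Lemma dcnP x y : feas CC x -> feas CC y ->
  [/\ dcn CC T x y \in nodes_at x, dcn CC T x y \in nodes_at y &
      forall w, w \in nodes_at x -> w \in nodes_at y -> w \in root_path (dcn CC T x y)].
Proof.
move=> feas_x feas_y; rewrite dcnE // /deepest.
case: arg_maxnP => [|w]; first by rewrite finset.in_setI !root_nodes_at.
rewrite finset.in_setI => /andP[w_x w_y] max_w; split=> // u u_x u_y.
by apply: (nodes_at_depth u_x w_x); apply: max_w; rewrite finset.in_setI u_x.
Qed.

(** If the chain of [x] left the node [u] through a child [c], the cover condition
    would give a child of [u] containing [y]; since [x] and [y] agree along
    the list of [u], this child is [c], which is then a common node below
    [u]. *)
Lemma nodes_at_sub x y u : feas CC y -> u \in nodes_at x -> u \in nodes_at y ->
  (forall w, w \in nodes_at x -> w \in nodes_at y -> w \in root_path u) ->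
  apply_list (slist u) x = apply_list (slist u) y ->
  nodes_at x \subset nodes_at y.
Proof.
move=> feas_y u_x u_y max_u eq_xy; apply/fintype.subsetP => w w_x.
case/orP: (nodes_at_chain u_x w_x) => [|in_wu]; last exact: nodes_at_up u_y.
case/root_path_split => p [[|c q] [walk_p last_p /=]]; first by move=> _ <-.
move=> /andP[e_c walk_q] last_q.
have c_x : c \in nodes_at x.
  apply: nodes_at_up w_x; rewrite -last_q.
  have -> : last c q = last root (rcons p c ++ q) by rewrite last_cat last_rcons.
  rewrite mem_root_path; first by rewrite inE mem_cat mem_rcons inE eqxx orbT.
  by rewrite cat_path rcons_path walk_p last_p e_c last_rcons.
have [c' e_c' Bc'] := tree_cover consT (ex_intro _ c e_c) feas_y.
have eq_c : c = c'.
  by apply: bconstr_sibling e_c e_c' eq_xy _ Bc'; apply: (nodes_atP _ _ c_x);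
    apply: root_path_refl.
have c_y : c \in nodes_at y.
  apply/nodes_atP => v; rewrite (root_path_edge e_c) in_setU1 => /predU1P[->|].
    by rewrite eq_c.
  exact: (nodes_atP _ _ u_y).
by have := edge_notin_root_path e_c; rewrite max_u.
Qed.

(** Equality along the list at the deepest common node forces the points into the
    same leaf; without this, the non-strict relation would not compose with the
    strict one to a strict one. *)
Lemma dcn_eq_nodes_at x y : feas CC x -> feas CC y ->
  apply_list (slist (dcn CC T x y)) x = apply_list (slist (dcn CC T x y)) y ->
  nodes_at x = nodes_at y.
Proof.
move=> feas_x feas_y eq_xy; have [w_x w_y max_w] := dcnP feas_x feas_y.
apply/eqP; rewrite finset.eqEsubset (nodes_at_sub feas_y w_x w_y max_w eq_xy).
by apply: (nodes_at_sub feas_x w_y w_x) => // w *; apply: max_w.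
Qed.

(** * The strict relation of the tree *)

Variable eps : R.
Hypothesis eps_gt0 : 0 < eps.

(** The nodes [dcn x y] and [dcn y z] both hold at [y], so one is above the other;
    the upper one then holds at all three points, hence lies above [dcn x z]. *)
Lemma tree_gt_trans x y z : feas CC x -> feas CC y -> feas CC z ->
  tree_gt CC T eps x y -> tree_gt CC T eps y z -> tree_gt CC T eps x z.
Proof.
move=> feas_x feas_y feas_z /lex_gtP gt_xy /lex_gtP gt_yz; apply/lex_gtP => //.
apply: lex_beats_trans (eps_gt0) (gt_xy eps_gt0) (gt_yz eps_gt0) _.
have [u_x u_y _] := dcnP feas_x feas_y; have [v_y v_z _] := dcnP feas_y feas_z.
have [_ _ max_w] := dcnP feas_x feas_z.
case/orP: (nodes_at_chain u_y v_y) => [in_uv|in_vu]; [left|right]; split;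
  apply: slist_root_path => //; apply: max_w => //.
  exact: nodes_at_up in_uv v_z.
exact: nodes_at_up in_vu u_x.
Qed.

(** Points that dominate each other through equality may be exchanged on either
    side of a comparison: the deepest common node with [y] depends only on their
    common chain, and it lies above [dcn x x'], where their lists agree. *)
Lemma dcn_eq_congr x x' y : feas CC x -> feas CC x' -> feas CC y ->
  apply_list (slist (dcn CC T x x')) x = apply_list (slist (dcn CC T x x')) x' ->
  dcn CC T x y = dcn CC T x' y /\
  apply_list (slist (dcn CC T x y)) x = apply_list (slist (dcn CC T x y)) x'.
Proof.
move=> feas_x feas_x' feas_y eq_xx'.
have eq_at := dcn_eq_nodes_at feas_x feas_x' eq_xx'.
split; first by rewrite !dcnE // eq_at.
have [u_x _ _] := dcnP feas_x feas_y; have [_ _ max_w] := dcnP feas_x feas_x'.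
apply: apply_list_eq_prefix eq_xx'; apply: slist_root_path.
by apply: max_w; rewrite // -eq_at.
Qed.

Lemma tree_ge_gt_trans x y z : feas CC x -> feas CC y -> feas CC z ->
  tree_ge CC T eps x y -> tree_gt CC T eps y z -> tree_gt CC T eps x z.
Proof.
move=> feas_x feas_y feas_z [eq_xy|gt_xy]; last exact: tree_gt_trans.
have [eq_dcn eq_list] := dcn_eq_congr feas_x feas_y feas_z eq_xy.
by rewrite /tree_gt eq_list eq_dcn.
Qed.

Lemma tree_gt_ge_trans x y z : feas CC x -> feas CC y -> feas CC z ->
  tree_gt CC T eps x y -> tree_ge CC T eps y z -> tree_gt CC T eps x z.
Proof.
move=> feas_x feas_y feas_z gt_xy [eq_yz|]; last exact: tree_gt_trans.
have [eq_dcn eq_list] := dcn_eq_congr feas_y feas_z feas_x eq_yz.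
by rewrite /tree_gt dcnC // -eq_dcn -eq_list dcnC.
Qed.

(** The label of a point is its chain: on points with a common chain [D] the
    relation compares them along the single list at the deepest node of [D]. *)
Lemma tree_gt_maximal (S : set 'rV[R]_n) : S !=set0 -> S `<=` feas CC ->
  exists2 m, S m & forall y, S y -> ~ tree_gt CC T eps y m.
Proof.
move=> S0 feas_S; apply: (maximal_by_label (label := nodes_at)) => //.
  by move=> x y z /feas_S ? /feas_S ? /feas_S ?; apply: tree_gt_trans.
move=> D S' SS' label_S' S'0; pose s := slist (deepest (D :&: D)).
have feas_S' y : S' y -> feas CC y by move=> /SS'/feas_S.
have [|m S'm max_m] := lex_beats_maximal eps_gt0 (c := coord s) (k := size s) S'0.
  move=> i lt_i; have [b ub_b] := tree_bounded consT (Ordinal lt_i).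
  exists b => _ [x S'x <-]; apply: ub_b.
  by exists x; rewrite ?apply_listE //; apply: feas_S'.
exists m => // y S'y /lex_gtP gt_ym; apply: (max_m y S'y); move: (gt_ym eps_gt0).
by rewrite dcnE ?label_S' //; apply: feas_S'.
Qed.

End Tree.

(** * Adding a constraint by strict dominance *)

Theorem theorem7 (R : realType) (n : nat)
    (F : set 'rV[R]_n) (f : 'rV[R]_n -> R)
    (CC DD : set (set 'rV[R]_n)) (g : 'rV[R]_n -> R) (z : \bar R)
    (T : branching_tree R n) (eps : R) (C : set 'rV[R]_n) :
  valid F f CC DD g z T eps ->
  (exists omega : 'rV[R]_n -> 'rV[R]_n,
     forall x : 'rV[R]_n, feas (CC `|` DD) x -> ~ C x ->
       [/\ feas CC (omega x), tree_gt CC T eps (omega x) x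
         & g (omega x) <= g x]) ->
  valid F f CC (DD `|` [set C]) g z T eps.
Proof.
move=> [z_neq [consT eps_gt0] wit val dom] [omega omegaP]; split=> // x feas_x lt_gx.
have feasW y : feas (CC `|` DD) y -> feas CC y.
  by move=> feas_y A CA; apply: feas_y; left.
pose S := [set y | [/\ feas (CC `|` DD) y, tree_ge CC T eps y x & g y <= g x]].
have [||m [feas_m ge_mx le_gm] max_m] := @tree_gt_maximal _ _ _ _ consT _ eps_gt0 S.
- by have [y Sy] := dom x feas_x lt_gx; exists y.
- by move=> y [/feasW].
have [Cm|notCm] := pselect (C m).
  by exists m; split=> // A; rewrite setUA => -[/feas_m //|->].
have [feas_om gt_om le_gom] := omegaP m feas_m notCm.
have [|y [feas_y ge_y le_gy]] := dom (omega m) feas_om.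
  by apply: le_lt_trans lt_gx; rewrite lee_fin (le_trans le_gom).
have gt_ym : tree_gt CC T eps y m.
  by apply: (tree_ge_gt_trans consT eps_gt0 _ feas_om _ ge_y gt_om); apply: feasW.
case: (max_m y) => //; split=> //; last by rewrite (le_trans le_gy) ?(le_trans le_gom).
right; apply: (tree_gt_ge_trans consT eps_gt0 _ _ feas_x gt_ym ge_mx); exact: feasW.
Qed.
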